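(* Let $1<p<\infty$ with $p\neq 2$. Then there exists $\tau_p\in(1,2)$ such that $$\Omega_p=\mathbb{C}\setminus \tfrac{1}{\tau_p}\overline{\mathbb{D}}=\{z\in\mathbb{C}: |z|>1/\tau_p\}.$$
   Context: $\mathbb{D}=\{z\in\mathbb{C}:|z|<1\}$, $\overline{\mathbb{D}}$ is its closure, $\mathbb{N}=\{1,2,3,\dots\}$. For $1<p<\infty$, $\ell^p_A$ is the Banach space of power series $f(z)=\sum_{k\ge 0}a_kz^k$ (complex coefficients) with $\|f\|_p=\left(\sum_{k\ge0}|a_k|^p\right)^{1/p}<\infty$; these are analytic functions on $\mathbb{D}$. $\mathscr{P}_n$ is the space of complex polynomials of degree at most $n$. For nonzero $f\in\ell^p_A$ and an integer $n\ge 0$, the optimal polynomial approximant $p_{n,f}$ is the unique element of $\mathscr{P}_n$ with $\|1-p_{n,f}f\|_p=\inf_{q\in\mathscr{P}_n}\|1-qf\|_p$. The set $\Omega_p\subseteq\mathbb{C}$ consists of all $z_0\in\mathbb{C}$ for which there exist $f\in\ell^p_A$ with $f(0)\neq0$ and $n\in\mathbb{N}$ such that $p_{n,f}(z_0)=0$. *)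

(* Defs.v *)
From HB Require Import structures.
From mathcomp Require Import all_boot all_order all_algebra.
From mathcomp Require Import complex.
From mathcomp Require Import all_classical all_reals all_analysis.
Set Implicit Arguments.
Unset Strict Implicit.
Unset Printing Implicit Defensive.
Import Order.TTheory GRing.Theory Num.Theory.
Import numFieldNormedType.Exports.
Export ComplexField.Normc.

Local Open Scope classical_set_scope.
Local Open Scope complex_scope.
Local Open Scope ring_scope.

(* A formal power series sum_k a_k z^k is represented by its coefficient
   sequence a : nat -> R[i]; its value at 0 is a 0. *)
Definition power_series (R : realType) := nat -> R[i].

(* (sum_k |a_k|^p)^(1/p), in \bar R: it is +oo when the sum diverges. *)
Definition lpA_norm (R : realType) (p : R) (a : power_series R) : \bar R :=
  Lnorm (@counting nat R) p%:E (fun k => (normc (a k))%:E).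

Definition lpA (R : realType) (p : R) : set (power_series R) :=
  [set a | (lpA_norm p a < +oo)%E].

(* Cauchy product of a polynomial and a power series. *)
Definition poly_mul_series (R : realType) (q : {poly R[i]}) (f : power_series R) :
    power_series R :=
  fun k => \sum_(i < k.+1) q`_i * f (k - i)%N.

(* || 1 - q f ||_p *)
Definition opa_error (R : realType) (p : R) (f : power_series R) (q : {poly R[i]}) :
    \bar R :=
  lpA_norm p (fun k => (k == 0%N)%:R - poly_mul_series q f k).

Definition poly_deg_le (R : realType) (n : nat) : set {poly R[i]} :=
  [set q | (size q <= n.+1)%N].
Arguments poly_deg_le : clear implicits.

(* q = p_{n,f}.  For 1 < p < oo and nonzero f in lpA p the minimizer exists and
   is unique, so the approximant is determined by this predicate. *)
Definition is_opa (R : realType) (p : R) (n : nat) (f : power_series R)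
    (q : {poly R[i]}) : Prop :=
  poly_deg_le R n q /\
  opa_error p f q = ereal_inf [set opa_error p f r | r in poly_deg_le R n].

Definition Omega (R : realType) (p : R) : set R[i] :=
  [set z0 | exists (f : power_series R) (n : nat) (q : {poly R[i]}),
     [/\ lpA p f, f 0%N != 0, (1 <= n)%N, is_opa p n f q & root q z0]].

Definition unit_disc (R : realType) : set R[i] := [set z | normc z < 1].
Arguments unit_disc : clear implicits.

Definition closed_unit_disc (R : realType) : set R[i] :=
  closure (unit_disc R : set R[i]^o).
Arguments closed_unit_disc : clear implicits.

(* Main.v *)
(* Dividing a zero z0 out of p_{n,f} leaves a multiple of z - z0 that is optimal
   for a series g with g(0) <> 0.  Write J(w) = |w|^(p-2) conj(w), B for the
   backward shift and s = 1/|z0|.  Optimality in the direction z g says, after a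
   rotation, that F(s, g) = sum_k J((Bg - s g)_k) g_k vanishes; optimality in the
   direction g can always be met by choosing the constant coefficient of the error.
   Finite sequences placed one after the other, separated by a zero, add up
   their values of F(s, .), and F(s, (1)) < 0, so s occurs if and only if
   Re F(s, g) > 0 for some finite g.  The set of such s > 0 is an open interval
   ]0, tau[, because F is continuous and decreasing in s.  Clarkson's inequality
   applied to (Bg)_k and (s g - Bg)_k gives s^p <= max(2, 2^(p-1)) < 2^p, and an
   explicit staircase g has Re F(1, g) > 0 for p <> 2. *)
Require Import Defs.
From mathcomp Require Import all_boot all_order all_algebra.
From mathcomp Require Import complex.
From mathcomp Require Import all_classical all_reals all_analysis.
From mathcomp Require Import ring lra.
Import Order.TTheory GRing.Theory Num.Theory.
Import numFieldNormedType.Exports.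
Set Implicit Arguments.
Unset Strict Implicit.
Unset Printing Implicit Defensive.
Local Open Scope classical_set_scope.
Local Open Scope complex_scope.
Local Open Scope ring_scope.

Local Notation Re := complex.Re.
Local Notation Im := complex.Im.

(** * The duality map of the complex plane *)

Section Scalars.
Context {R : realType}.
Implicit Types (x y : R) (z w v : R[i]).

Lemma normcE z : normc z = Num.sqrt ((Re z) ^+ 2 + (Im z) ^+ 2).
Proof. by case: z. Qed.

Lemma normc_ge0 z : 0 <= normc z.
Proof. by rewrite normcE sqrtr_ge0. Qed.

Lemma normc_sqrE z : normc z ^+ 2 = Re z ^+ 2 + Im z ^+ 2.
Proof. by rewrite normcE sqr_sqrtr// addr_ge0 ?sqr_ge0. Qed.

Lemma normc_eq0 z : (normc z == 0) = (z == 0).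
Proof. by apply/eqP/eqP => [/eq0_normc//|->]; rewrite normc0. Qed.

Lemma normc_gt0 z : (0 < normc z) = (z != 0).
Proof. by rewrite lt_def normc_ge0 andbT normc_eq0. Qed.

Lemma normc_real x : normc x%:C = `|x|.
Proof. by rewrite normcE /= expr0n addr0 sqrtr_sqr. Qed.

Lemma normc_conj z : normc (conjc z) = normc z.
Proof. by case: z => a b /=; rewrite sqrrN. Qed.

Lemma conjcM z w : conjc (z * w) = conjc z * conjc w.
Proof. by case: z w => a b [c d]; simpc; congr (_ +i* _); ring. Qed.

Lemma conjc_realE x : conjc x%:C = x%:C :> R[i].
Proof. by rewrite /= oppr0. Qed.

Lemma mul_conjc z : conjc z * z = (normc z ^+ 2)%:C.
Proof. by rewrite normc_sqrE; case: z => a b; simpc; congr (_ +i* _) => /=;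
  ring. Qed.

Lemma Re_le_normc z : Re z <= normc z.
Proof.
apply: (le_trans (ler_norm _)); rewrite -sqrtr_sqr normcE.
by rewrite ler_wsqrtr// lerDl sqr_ge0.
Qed.

Lemma ReD z w : Re (z + w) = Re z + Re w.
Proof. by case: z w => a b [c d]. Qed.

Lemma ReN z : Re (- z) = - Re z.
Proof. by case: z. Qed.

Lemma Re_realM x z : Re (x%:C * z) = x * Re z.
Proof. by case: z => a b; simpc. Qed.

Lemma Re_mulrCA x z w : Re (z * (x%:C * w)) = x * Re (z * w).
Proof. by rewrite mulrCA Re_realM. Qed.

Lemma Re_sum (I : Type) (r : seq I) (F : I -> R[i]) :
  Re (\sum_(i <- r) F i) = \sum_(i <- r) Re (F i).
Proof. by elim/big_rec2: _ => // i y z _ <-; rewrite ReD. Qed.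

Lemma powR_addr (x r s : R) : 0 < x -> x `^ (r + s) = x `^ r * x `^ s.
Proof. by move=> x0; rewrite powRD// (gt_eqF x0) implybT. Qed.

(* This is Young's inequality for x and y^(p-1). *)
Lemma powR_tangent (p x y : R) : 1 < p -> 0 <= x -> 0 <= y ->
  y `^ p + p * (y `^ (p - 1) * (x - y)) <= x `^ p.
Proof.
move=> p1 x0 y0; have p0 : 0 < p by lra.
have q0 : 0 < p / (p - 1) by rewrite divr_gt0//; lra.
have := conjugate_powR x0 (powR_ge0 y (p - 1)) p0 q0.
rewrite -powRrM; have -> : (p - 1) * (p / (p - 1)) = p by field; do ?[split]; lra.
have -> : p^-1 + (p / (p - 1))^-1 = 1 by field; do ?[split]; lra.
move=> /(_ erefl); have := mulr_powRB1 y0 p0.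
set Y := y `^ p; set Z := y `^ (p - 1); set X := x `^ p => YZ H.
have : p * (x * Z) <= p * (X / p + Y / (p / (p - 1))) by rewrite ler_pM2l.
have e : p * (X / p + Y / (p / (p - 1))) = X + Y * (p - 1)
  by field; do ?[split]; lra.
by rewrite e -YZ; nra.
Qed.

(** The derivative of |w|^p in the direction v is p Re ([dual p w] * v). The factor [conjc w] gives
    the value 0 at w = 0, whatever p is. *)
Definition dual (p : R) w : R[i] := (normc w `^ (p - 2))%:C * conjc w.

Lemma dual0 p : dual p 0 = 0.
Proof. by rewrite /dual rmorph0 mulr0. Qed.

Lemma dualM p z w : dual p (z * w) = dual p z * dual p w.
Proof.
by rewrite /dual normcM powRM ?normc_ge0// conjcM rmorphM/= mulrACA.
Qed.

Lemma dual_conj p z : dual p (conjc z) = conjc (dual p z).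
Proof.
by rewrite /dual normc_conj conjcM conjc_realE.
Qed.

Lemma dual_real p x : 0 < x -> dual p x%:C = (x `^ (p - 1))%:C.
Proof.
move=> x0; rewrite /dual normc_real gtr0_norm//= -[in LHS]complexr0 oppr0.
rewrite complexr0 -rmorphM/= -{2}(powRr1 (ltW x0)) -powR_addr//.
by congr ((_ `^ _)%:C); ring.
Qed.

Lemma dualN p w : dual p (- w) = - dual p w.
Proof.
rewrite -mulN1r dualM; suff -> : dual p (-1) = -1 by rewrite mulN1r.
have -> : -1 = (-1)%:C :> R[i] by rewrite rmorphN rmorph1.
by rewrite /dual normc_real normrN1 powR1 mul1r conjc_realE.
Qed.

Lemma normc_dual p w : 1 < p -> normc (dual p w) = normc w `^ (p - 1).
Proof.
move=> p1; have [->|w0] := eqVneq w 0.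
  by rewrite dual0 normc0 powR0//; lra.
rewrite normcM normc_conj normc_real ger0_norm ?powR_ge0//.
rewrite -{2}(powRr1 (normc_ge0 w)) -powR_addr ?normc_gt0//.
by congr (_ `^ _); ring.
Qed.

Lemma dual_mul p w : 1 < p -> dual p w * w = (normc w `^ p)%:C.
Proof.
move=> p1; have [->|w0] := eqVneq w 0.
  by rewrite mulr0 normc0 powR0//; lra.
rewrite -mulrA mul_conjc -rmorphM/= -powR_mulrn ?normc_ge0// -powR_addr ?normc_gt0//.
by congr ((_ `^ _)%:C); ring.
Qed.

Lemma dual_surj p v : 1 < p -> exists w, dual p w = v.
Proof.
move=> p1; have [->|v0] := eqVneq v 0; first by exists 0; rewrite dual0.
have nv : 0 < normc v by rewrite normc_gt0.
(* [dual] raises the modulus to the power p - 1 and conjugates the argument; the witness undoes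
   both. *)
exists ((normc v `^ ((p - 1)^-1))%:C * (conjc v / (normc v)%:C)).
rewrite dualM dual_real ?powR_gt0// -powRrM mulVf ?powRr1 ?normc_ge0//; last by lra.
rewrite dualM -rmorphV/= ?unitfE ?gt_eqF// dual_real ?invr_gt0//.
rewrite dual_conj/= /dual conjcM conjc_realE conjcK.
rewrite !mulrA mulrAC -!rmorphM/= -[(normc v)^-1]powR_inv1 ?normc_ge0//.
rewrite -powRrM -{1}(powRr1 (normc_ge0 v)) -!powR_addr//.
have -> : 1 + (p - 2) + -1 * (p - 1) = 0 by ring.
by rewrite powRr0 mul1r.
Qed.

(** Since Re (conj(w) v) <= |w| (|w + v| - |w|), the scalar tangent inequality suffices. *)
Lemma normc_tangent p w v : 1 < p ->
  normc w `^ p + p * Re (dual p w * v) <= normc (w + v) `^ p.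
Proof.
move=> p1; have [->|w0] := eqVneq w 0.
  by rewrite dual0 mul0r normc0 powR0 ?mulr0 ?add0r ?powR_ge0//; lra.
have nw : 0 < normc w by rewrite normc_gt0.
apply: le_trans _ (powR_tangent p1 (normc_ge0 (w + v)) (normc_ge0 w)).
rewrite lerD2l ler_pM2l; last by lra.
have -> : Re (dual p w * v) = normc w `^ (p - 2) * Re (conjc w * v).
  by rewrite -mulrA Re_realM.
have -> : normc w `^ (p - 1) = normc w `^ (p - 2) * normc w.
  rewrite -{3}(powRr1 (normc_ge0 w)) -powR_addr//.
  by congr (_ `^ _); ring.
rewrite -mulrA ler_pM2l ?powR_gt0//.
have := Re_le_normc (conjc w * (w + v)).
rewrite normcM normc_conj mulrDr mul_conjc ReD/=; lra.
Qed.

Lemma normc_convex p w v (e : R) : 1 < p -> 0 <= e <= 1 ->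
  normc (w + e%:C * v) `^ p <= (1 - e) * normc w `^ p + e * normc (w + v) `^ p.
Proof.
move=> p1 /andP[e0 e1]; set m := w + e%:C * v.
(* Tangent inequalities at the intermediate point m, averaged with weights 1 - e and e: the linear
   terms cancel. *)
have := normc_tangent m (- (e%:C * v)) p1.
have := normc_tangent m ((1 - e)%:C * v) p1.
have -> : m + - (e%:C * v) = w by rewrite /m addrK.
have -> : m + (1 - e)%:C * v = w + v by rewrite /m rmorphB/= rmorph1; ring.
rewrite mulrN ReN !Re_mulrCA.
set A := normc m `^ p; set t := Re _; set B := _ `^ p; set D := _ `^ p.
move=> H1 H2.
have -> : A = (1 - e) * (A + p * - (e * t)) + e * (A + p * ((1 - e) * t)) by ring.
by apply: lerD; apply: ler_wpM2l => //; lra.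
Qed.

(** Adding the tangent inequalities at w and w + v shows that the gradient of a convex function is
    monotone. *)
Lemma dual_mono p w v : 1 < p -> Re (dual p w * v) <= Re (dual p (w + v) * v).
Proof.
move=> p1; have := normc_tangent w v p1; have := normc_tangent (w + v) (- v) p1.
by rewrite addrK mulrN ReN; nra.
Qed.

End Scalars.

(** * Clarkson's inequality and continuity *)

Section Powers.
Context {R : realType}.
Implicit Types (x y : R) (z w v : R[i]).

Lemma powR_superadd (q x y : R) : 1 <= q -> 0 <= x -> 0 <= y ->
  x `^ q + y `^ q <= (x + y) `^ q.
Proof.
move=> q1 x0 y0.
have q0 : 0 < q by lra.
rewrite -(mulr_powRB1 x0 q0) -(mulr_powRB1 y0 q0) -(mulr_powRB1 (addr_ge0 x0 y0) q0).
rewrite mulrDl lerD// ler_wpM2l//; apply: ge0_ler_powR => //; rewrite ?nnegrE; lra.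
Qed.

Lemma powR_mean (q x y : R) : 1 < q -> 0 <= x -> 0 <= y ->
  2 * ((x + y) / 2) `^ q <= x `^ q + y `^ q.
Proof.
move=> q1 x0 y0; have m0 : 0 <= (x + y) / 2 by lra.
have := lerD (powR_tangent q1 x0 m0) (powR_tangent q1 y0 m0).
by apply: le_trans; rewrite le_eqVlt; apply/orP; left; apply/eqP; field.
Qed.

(** This is superadditivity for the exponent 1/q, applied to x^q and y^q. *)
Lemma powR_subadd (q x y : R) : 0 < q < 1 -> 0 <= x -> 0 <= y ->
  (x + y) `^ q <= x `^ q + y `^ q.
Proof.
move=> /andP[q0 q1] x0 y0.
have iq : 1 <= q^-1 by rewrite invf_ge1 ?ltW.
have := powR_superadd iq (powR_ge0 x q) (powR_ge0 y q).
rewrite -!powRrM mulfV ?gt_eqF// !powRr1// => /(ge0_ler_powR (ltW q0)).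
rewrite -powRrM mulVf ?gt_eqF// powRr1 ?addr_ge0 ?powR_ge0//; apply.
  by rewrite nnegrE addr_ge0.
by rewrite nnegrE powR_ge0.
Qed.

Lemma powR_mean_concave (q x y : R) : 0 < q < 1 -> 0 <= x -> 0 <= y ->
  x `^ q + y `^ q <= 2 * ((x + y) / 2) `^ q.
Proof.
move=> /andP[q0 q1] x0 y0.
have iq : 1 < q^-1 by rewrite invf_gt1.
have := powR_mean iq (powR_ge0 x q) (powR_ge0 y q).
rewrite -!powRrM mulfV ?gt_eqF// !powRr1//.
set m := (_ + _) / 2; have m0 : 0 <= m by rewrite /m divr_ge0// addr_ge0 ?powR_ge0.
move=> H; have {}H : m `^ q^-1 <= (x + y) / 2 by lra.
have := ge0_ler_powR (ltW q0) (powR_ge0 _ _) _ H.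
rewrite -powRrM mulVf ?gt_eqF// powRr1// nnegrE => /(_ ltac:(lra)).
by rewrite /m; lra.
Qed.

(* Clarkson's inequalities, with C = 2 for p < 2 and C = 2^(p-1) for p > 2. *)
Lemma clarkson (p : R) : 1 < p -> p != 2 -> exists C : R,
  [/\ 0 <= C, C < 2 `^ p &
    forall a b : R[i], normc (a + b) `^ p + normc (a - b) `^ p <=
      C * (normc a `^ p + normc b `^ p)].
Proof.
move=> p1 p2.
(* In terms of squared moduli, the parallelogram law reduces the claim to scalar inequalities for
   the exponent p/2, which is below or above 1. *)
have E (z : R[i]) : normc z `^ p = (normc z ^+ 2) `^ (p / 2).
  by rewrite -powR_mulrn ?normc_ge0// -powRrM; congr (_ `^ _); field.
have para (a b : R[i]) :
    normc (a + b) ^+ 2 + normc (a - b) ^+ 2 = 2 * (normc a ^+ 2 + normc b ^+ 2).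
  by rewrite !normc_sqrE; case: a b => a a' [b b'] /=; ring.
have [lt2|gt2|/eqP] := ltgtP p 2; last by rewrite (negbTE p2).
- exists 2; split => //.
    rewrite -{1}(powRr1 (ltW (ltr0n _ 2)))//.
    by rewrite /powR pnatr_eq0/= ltr_expR ltr_pM2r// ln_gt0// ltr1n.
  move=> a b; rewrite !E.
  have q01 : 0 < p / 2 < 1 by lra.
  apply: (le_trans (powR_mean_concave q01 (sqr_ge0 _) (sqr_ge0 _))).
  rewrite ler_pM2l// para [2 * _]mulrC mulfK//.
  by apply: powR_subadd => //; apply: sqr_ge0.
- exists (2 `^ p / 2); split => [||a b].
  + by rewrite divr_ge0 ?powR_ge0.
  + by rewrite ltr_pdivrMr// ltr_pMr ?powR_gt0// ltr1n.
  rewrite !E; have q1 : 1 < p / 2 by lra.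
  apply: (le_trans (powR_superadd (ltW q1) (sqr_ge0 _) (sqr_ge0 _))).
  rewrite para.
  have -> : 2 * (normc a ^+ 2 + normc b ^+ 2) =
      2 ^+ 2 * ((normc a ^+ 2 + normc b ^+ 2) / 2).
    by field.
  rewrite powRM ?exprn_ge0// ?divr_ge0 ?addr_ge0 ?sqr_ge0//.
  rewrite -powR_mulrn// -powRrM (_ : 2 * (p / 2) = p); last by field.
  rewrite -mulrA ler_pM2l ?powR_gt0//.
  by have := powR_mean q1 (sqr_ge0 (normc a)) (sqr_ge0 (normc b)); lra.
Qed.

Lemma continuous_dual (p : R) z w : 1 < p ->
  continuous (fun s : R => Re (dual p (z - s%:C * w) * w)).
Proof.
move=> p1 s0.
(* If the base is nonzero at s0, the power of its squared modulus is differentiable there, even for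
   p < 2. *)
have [zw|zw] := eqVneq z (s0%:C * w); last first.
  have E s : Re (dual p (z - s%:C * w) * w) =
      (normc (z - s%:C * w) ^+ 2) `^ ((p - 2) / 2) * Re (conjc (z - s%:C * w) * w).
    rewrite -mulrA Re_realM -powR_mulrn ?normc_ge0// -powRrM.
    by congr (_ `^ _ * _); field.
  have Q s : normc (z - s%:C * w) ^+ 2 =
      (Re z - s * Re w) ^+ 2 + (Im z - s * Im w) ^+ 2.
    by rewrite normc_sqrE; case: z w {zw E} => a b [c d]; simpc.
  have L s : Re (conjc (z - s%:C * w) * w) =
     (Re z - s * Re w) * Re w + (Im z - s * Im w) * Im w.
    by case: z w {zw E Q} => a b [c d]; simpc; rewrite /=; ring.
  have -> : (fun s : R => Re (dual p (z - s%:C * w) * w)) =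
      ((fun x => x `^ ((p - 2) / 2)) \o
      (fun s => (Re z - s * Re w) ^+ 2 + (Im z - s * Im w) ^+ 2)) \*
      (fun s => (Re z - s * Re w) * Re w + (Im z - s * Im w) * Im w).
    by apply/funext => s; rewrite E Q L.
  have clin (a b : R) : {for s0, continuous (fun s : R => a - s * b)}.
    apply: cvgB; [exact: cvg_cst|apply: cvgM; [exact: cvg_id|exact: cvg_cst]].
  apply: cvgM; last first.
    by apply: cvgD; (apply: cvgM; [exact: clin|exact: cvg_cst]).
  apply: continuous_comp.
    by apply: cvgD; (under eq_fun do rewrite expr2; apply: cvgM; exact: clin).
  rewrite -Q; apply: differentiable_continuous; apply/derivable1_diffP.
  apply: derivable_powR; rewrite in_itv/= andbT exprn_gt0// normc_gt0.
  by rewrite subr_eq0.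
(* When z = s0 w, the function has size at most |w|^p |s0 - s|^(p-1), which tends to 0 because p >
   1. *)
have E s : Re (dual p (z - s%:C * w) * w) = normc w `^ p * Re (dual p (s0 - s)%:C).
  rewrite zw -mulrBl -rmorphB/= dualM -mulrA dual_mul// mulrC Re_realM//.
rewrite (funext E); apply: cvgM; first exact: cvg_cst.
rewrite subrr dual0; apply/cvgrPdist_lt => e e0.
near=> s; rewrite sub0r normrN.
have : `|Re (dual p (s0 - s)%:C)| <= `|s0 - s| `^ (p - 1).
  rewrite -[`|s0 - s|]normc_real -normc_dual//; rewrite ler_norml Re_le_normc andbT.
  by rewrite lerNl -ReN (le_trans (Re_le_normc _))// normcN.
move/le_lt_trans; apply.
have -> : e = (e `^ ((p - 1)^-1)) `^ (p - 1).
  by rewrite -powRrM mulVf ?powRr1 ?ltW//; lra.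
apply: gt0_ltr_powR; rewrite ?nnegrE ?powR_ge0//; first lra.
near: s; apply: cvgr_dist_lt; [exact: cvg_id|by rewrite powR_gt0].
Unshelve. all: by end_near. Qed.

End Powers.

(** * Pairings of finite sequences *)

Section Pairing.
Context {R : realType}.
Implicit Types (s : R) (l : seq R[i]).

(* The finite sequence l is continued by zeros: nth returns 0 at index size l. *)
Definition pairing (p s : R) l : R[i] :=
  \sum_(k < size l) dual p (l`_k.+1 - s%:C * l`_k) * l`_k.

Lemma pairing_cons p s (z : R[i]) l :
  pairing p s (z :: l) = dual p (l`_0 - s%:C * z) * z + pairing p s l.
Proof. by rewrite /pairing big_ord_recl. Qed.

(** The separating zero follows the last entry of l1 just as the default value would, and its own
    term has weight 0. *)
Lemma pairing_cat0 p s l1 l2 :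
  pairing p s (l1 ++ 0 :: l2) = pairing p s l1 + pairing p s l2.
Proof.
elim: l1 => [|z l1 IH].
  by rewrite pairing_cons mulr0 {2}/pairing big_ord0.
rewrite cat_cons !pairing_cons IH addrA; congr (dual p (_ - _) * _ + _ + _).
by case: l1 {IH}.
Qed.

Lemma pairing_conj p s l : pairing p s (map conjc l) = conjc (pairing p s l).
Proof.
elim: l => [|z l IH]; first by rewrite /pairing !big_ord0 conjc_realE.
rewrite /= !pairing_cons IH rmorphD/= conjcM -dual_conj rmorphB/= conjcM conjc_realE.
by congr (dual p (_ - _) * _ + _); case: (l) => [|w l']; rewrite /= ?oppr0.
Qed.

Lemma pairing_mkseq p s (g : nat -> R[i]) N : Re (pairing p s (mkseq g N.+1)) =
  \sum_(k < N) Re (dual p (g k.+1 - s%:C * g k) * g k)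
  + Re (dual p (- (s%:C * g N)) * g N).
Proof.
set l := mkseq _ _; have sl : size l = N.+1 by rewrite size_mkseq.
have lE j : (j < N.+1)%N -> l`_j = g j by move=> jn; rewrite nth_mkseq.
have l0 : l`_N.+1 = 0 by rewrite nth_default ?sl.
rewrite /pairing; clearbody l; rewrite sl Re_sum big_ord_recr/= l0 lE// sub0r.
congr (_ + _); apply: eq_bigr => k _.
by rewrite !lE ?ltnS ?(ltn_ord k) ?(ltnW (ltn_ord k)).
Qed.

Lemma pairing_mono p s s' l : 1 < p -> s <= s' ->
  Re (pairing p s' l) <= Re (pairing p s l).
Proof.
move=> p1 ss'; rewrite /pairing !Re_sum; apply: ler_sum => k _.
have [->|ne] := eqVneq s s'; first by [].
have d0 : 0 < s' - s by rewrite subr_gt0 lt_neqAle ne.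
have := dual_mono (l`_k.+1 - s'%:C * l`_k) ((s' - s)%:C * l`_k) p1.
rewrite !Re_mulrCA (ler_pM2l d0); congr (_ <= Re (dual p _ * _)).
by rewrite rmorphB/=; ring.
Qed.

Lemma pairing_continuous p l : 1 < p ->
  continuous (fun s => Re (pairing p s l)).
Proof.
move=> p1; elim: l => [|z l IH] s0.
  by under eq_fun do rewrite /pairing big_ord0; exact: cvg_cst.
under eq_fun do rewrite pairing_cons ReD.
by apply: cvgD; [exact: continuous_dual|exact: IH].
Qed.

(** The energy is convex in s with derivative -p Re ([pairing p s l]), so a nonnegative pairing at s
    means that it has not yet started to grow. *)
Lemma pairing_energy p s s' l : 1 < p -> 0 <= Re (pairing p s l) -> s' <= s ->
  \sum_(k < size l) normc (l`_k.+1 - s%:C * l`_k) `^ p <=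
  \sum_(k < size l) normc (l`_k.+1 - s'%:C * l`_k) `^ p.
Proof.
move=> p1 G0 ss'.
have : \sum_(k < size l) (normc (l`_k.+1 - s%:C * l`_k) `^ p +
    p * Re (dual p (l`_k.+1 - s%:C * l`_k) * ((s - s')%:C * l`_k))) <=
  \sum_(k < size l) normc (l`_k.+1 - s'%:C * l`_k) `^ p.
  apply: ler_sum => k _.
  have -> : l`_k.+1 - s'%:C * l`_k = (l`_k.+1 - s%:C * l`_k) + (s - s')%:C * l`_k.
    by rewrite rmorphB/=; ring.
  exact: normc_tangent.
apply: le_trans; rewrite big_split/= lerDl.
under eq_bigr do rewrite Re_mulrCA.
by rewrite -mulr_sumr -mulr_sumr -Re_sum !mulr_ge0// ?subr_ge0//; lra.
Qed.

(** Summing Clarkson's inequality for a = l_(k+1), b = s l_k - l_(k+1) gives s^p N + 2^p E(s/2) <= C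
    (E(0) + E(s)). Then C E(s) <= 2^p E(s/2) and E(0) <= N leave s^p N <= C N. *)
Lemma pairing_bound p s l (C : R) : 1 < p -> 0 <= C -> C < 2 `^ p ->
  (forall a b : R[i], normc (a + b) `^ p + normc (a - b) `^ p <=
      C * (normc a `^ p + normc b `^ p)) ->
  0 < s -> 0 < Re (pairing p s l) -> s `^ p <= C.
Proof.
move=> p1 C0 C2 HC s0 G0.
pose E s := \sum_(k < size l) normc (l`_k.+1 - s%:C * l`_k) `^ p.
pose N := \sum_(k < size l) normc l`_k `^ p.
have N0 : 0 < N.
  rewrite lt_def sumr_ge0 ?andbT => [|k _]; last exact: powR_ge0.
  apply: contraTN G0; rewrite psumr_eq0 => [/allP H|k _]; last exact: powR_ge0.
  rewrite /pairing big1 ?ltxx// => k _.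
  have := H k (mem_index_enum _); rewrite powR_eq0 normc_eq0.
  by move=> /andP[/eqP->]; rewrite mulr0.
have E0E : E 0 = \sum_(k < size l) normc l`_k.+1 `^ p.
  by apply: eq_bigr => k _; rewrite mul0r subr0.
have E0 : E 0 <= N.
  rewrite E0E.
  have : normc l`_0 `^ p + \sum_(k < size l) normc l`_k.+1 `^ p =
      N + normc l`_(size l) `^ p.
    transitivity (\sum_(k < (size l).+1) normc l`_k `^ p).
      by rewrite big_ord_recl.
    by rewrite big_ord_recr.
  (* The entry past the end is 0, so the shift only loses the first term. *)
  rewrite [l`_(size l)]nth_default// normc0 powR0; last by lra.
  by rewrite addr0 => <-; rewrite lerDr powR_ge0.
have Eh : E s <= E (s / 2) by apply: pairing_energy; [lra|exact: ltW|lra].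
have Epos : 0 <= E s by apply: sumr_ge0 => k _; apply: powR_ge0.
have : s `^ p * N + 2 `^ p * E (s / 2) <= C * (E 0 + E s).
  rewrite E0E /N /E !mulr_sumr -!big_split/= mulr_sumr; apply: ler_sum => k _.
  have := HC l`_k.+1 (s%:C * l`_k - l`_k.+1).
  rewrite [l`_k.+1 + _]addrC subrK normcM normc_real (gtr0_norm s0).
  rewrite (powRM _ (ltW s0) (normc_ge0 _)).
  have -> : normc (s%:C * l`_k - l`_k.+1) = normc (l`_k.+1 - s%:C * l`_k).
    by rewrite -normcN opprB.
  apply: le_trans; rewrite lerD2l.
  have -> : l`_k.+1 - (s%:C * l`_k - l`_k.+1) = 2%:C * (l`_k.+1 - (s / 2)%:C * l`_k).
    have -> : s%:C = 2%:C * (s / 2)%:C by rewrite -rmorphM/=; congr _%:C; field.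
    by rewrite (_ : 2%:C = 1 + 1 :> R[i]) ?rmorphD ?rmorph1//; ring.
  by rewrite normcM normc_real gtr0_norm// powRM ?normc_ge0.
have h1 := ler_wpM2l C0 E0; have h2 := ler_pM C0 Epos (ltW C2) Eh.
rewrite mulrDr => h; rewrite -(ler_pM2r N0).
by move: h h1 h2; clearbody E N; clear; lra.
Qed.

End Pairing.

(** * The threshold *)

Section Threshold.
Context {R : realType}.
Implicit Types (s : R) (l : seq R[i]).

Lemma powR_unbounded (e K : R) : 0 < e -> exists n : nat, K < n.+2%:R `^ e.
Proof.
move=> e0; pose M := `|K| `^ e^-1.
exists (Num.bound M); have M0 : 0 <= M by apply: powR_ge0.
apply: (le_lt_trans (ler_norm K)).
have -> : `|K| = M `^ e by rewrite /M -powRrM mulVf ?gt_eqF// powRr1.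
apply: gt0_ltr_powR => //; rewrite ?nnegrE ?ler0n//.
by apply: (lt_trans (archi_boundP M0)); rewrite ltr_nat.
Qed.

Lemma sum_succ (n : nat) : \sum_(k < n) (k.+1%:R : R) = n%:R * (n%:R + 1) / 2.
Proof.
elim: n => [|n IH]; first by rewrite big_ord0 mul0r mul0r.
by rewrite big_ord_recr/= IH -addn1 natrD; field.
Qed.

(** The unit steps earn 1 + ... + n, and the final fall from n + 1 to 0 costs (n + 1)^p. *)
Lemma pairing_up p (n : nat) : 1 < p ->
  Re (pairing p 1 (mkseq (fun k => k.+1%:R : R[i]) n.+1)) =
  n%:R * (n%:R + 1) / 2 - n.+1%:R `^ p.
Proof.
move=> p1; have R1 k : (k%:R : R[i]) = (k%:R)%:C by rewrite rmorph_nat.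
rewrite pairing_mkseq rmorph1 mul1r dualN mulNr ReN {2}R1.
rewrite R1 dual_mul// normc_real ger0_norm//; congr (_ - _).
rewrite -sum_succ; apply: eq_bigr => k _.
rewrite (_ : _ - _ = 1%:C).
  by rewrite dual_real// powR1 rmorph1 mul1r R1.
by rewrite rmorph1 mul1r -[k.+2]addn1 natrD addrC addKr.
Qed.

(** The entry n/2 earns the jump to n, whereas a jump from 0 would have weight 0. Each unit step
    down costs the height at which it starts. *)
Lemma pairing_down p (n : nat) : 1 < p ->
  Re (pairing p 1 ((n%:R / 2)%:C :: mkseq (fun k => (n - k)%:R : R[i]) n)) =
  (n%:R / 2) `^ p - n%:R * (n%:R + 1) / 2.
Proof.
move=> p1; have R1 k : (k%:R : R[i]) = (k%:R)%:C by rewrite rmorph_nat.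
rewrite pairing_cons rmorph1 mul1r ReD; congr (_ + _).
  rewrite (_ : _ - _ = (n%:R / 2)%:C).
    by rewrite dual_mul// normc_real ger0_norm ?divr_ge0.
  case: n => [|n].
    by have -> : (0%:R / 2)%:C = 0 :> R[i]; [rewrite mul0r rmorph0|rewrite subr0].
  rewrite nth_mkseq// subn0 R1 -rmorphB/=; set m := n.+1%:R.
  by rewrite (_ : m - m / 2 = m / 2)//; field.
rewrite /pairing size_mkseq Re_sum -sum_succ -sumrN.
rewrite (reindex_inj rev_ord_inj)/=; apply: eq_bigr => k _.
have kn := ltn_ord k.
have nE (j : nat) : (j <= n)%N ->
    (mkseq (fun k => (n - k)%:R : R[i]) n)`_j = (n - j)%:R.
  rewrite leq_eqVlt => /predU1P[->|jn]; last by rewrite nth_mkseq.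
  by rewrite nth_default ?size_mkseq// subnn.
rewrite !nE ?leq_subr//; last by rewrite subnSK// leq_subr.
rewrite subnSK// !subKn ?(ltnW kn)// (_ : _ - _ = - 1%:C).
  by rewrite dualN dual_real// powR1 rmorph1 mulN1r ReN R1.
by rewrite !rmorph1 mul1r -addn1 natrD opprD addNKr.
Qed.

Definition reachable (p s : R) := exists l, 0 < Re (pairing p s l).

(* For p < 2 the pairing rewards a slow ascent followed by a sudden drop, for
   p > 2 a sudden jump followed by a slow descent. *)
Lemma reachable1 p : 1 < p -> p != 2 -> reachable p 1.
Proof.
move=> p1 p2; have [lt2|gt2|E] := ltgtP p 2; last by rewrite E eqxx in p2.
(* With m = n + 2, 4 m^p < m^2 is enough, since m^2 <= 2 m (m - 1) for m >= 2. *)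
- have [n Hn] := @powR_unbounded (2 - p) 4 ltac:(lra).
  exists (mkseq (fun k => k.+1%:R : R[i]) n.+2); rewrite pairing_up//.
  have N2 : n.+2%:R = n.+1%:R + 1 :> R by rewrite -[in LHS]addn1 natrD.
  have N1 : 1 <= n.+1%:R :> R by rewrite ler1n.
  move: Hn; rewrite N2; set m := n.+1%:R + 1.
  have m0 : 0 < m by rewrite /m; lra.
  have -> : m `^ (2 - p) = m ^+ 2 / m `^ p.
    by rewrite powR_addr// powRN powR_mulrn// ltW.
  rewrite ltr_pdivlMr ?powR_gt0// => H.
  rewrite subr_gt0 -(ltr_pM2l (ltr0Sn _ 3)).
  by apply: (lt_le_trans H); rewrite /m; nra.
- have e0 : 0 < p - 2 by rewrite subr_gt0.
  (* m^(p-2) > 2^p means (m/2)^p > m^2, and m^2 >= m (m + 1)/2. *)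
  have [n Hn] := powR_unbounded (2 `^ p) e0.
  exists ((n.+2%:R / 2)%:C :: mkseq (fun k => (n.+2 - k)%:R : R[i]) n.+2).
  rewrite pairing_down//; set m := n.+2%:R in Hn *.
  have m2 : 2 <= m by rewrite ler_nat.
  have m0 : 0 < m by lra.
  move: Hn; have -> : m `^ (p - 2) = m `^ p / m ^+ 2.
    by rewrite powR_addr// powRN powR_mulrn// ltW.
  rewrite ltr_pdivlMr ?exprn_gt0// => H.
  have -> : (m / 2) `^ p = m `^ p / 2 `^ p.
    by rewrite powRM ?invr_ge0 ?ltW// -powR_inv1// -powRrM mulN1r powRN.
  rewrite subr_gt0 ltr_pdivlMr ?powR_gt0// mulrC; apply: le_lt_trans H.
  by rewrite ler_pM2l ?powR_gt0//; nra.
Qed.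

Lemma reachable_open p s : 1 < p -> reachable p s ->
  exists2 s', s < s' & reachable p s'.
Proof.
move=> p1 [l Hl].
have := @pairing_continuous R p l p1 s.
move=> /cvgr_gt /(_ _ Hl) [e /= e0 He].
exists (s + e / 2); first by rewrite ltrDl divr_gt0.
exists l; apply: He; rewrite /= opprD addNKr normrN gtr0_norm ?divr_gt0//.
by rewrite gtr_pMr// invf_lt1// ltr1n.
Qed.

(** tau is the supremum of the positive reachable parameters: openness excludes tau itself,
    monotonicity fills the interval below it, and Clarkson's constant gives tau <= C^(1/p) < 2. *)
Lemma reachable_threshold p : 1 < p -> p != 2 -> exists tau : R,
  1 < tau < 2 /\ forall s, 0 < s -> reachable p s <-> s < tau.
Proof.
move=> p1 p2; have [C [C0 C2 HC]] := clarkson p1 p2.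
pose S := [set s : R | 0 < s /\ reachable p s].
have S1 : S 1 by split => //; exact: reachable1.
have p0 : 0 < p by lra.
have ubS : ubound S (C `^ p^-1).
  move=> s [s0 [l Hl]].
  have -> : s = (s `^ p) `^ p^-1.
    by rewrite -powRrM mulfV ?gt_eqF// powRr1 ?ltW.
  apply: ge0_ler_powR; rewrite ?nnegrE ?powR_ge0 ?invr_ge0 ?(ltW p0)//.
  exact: (pairing_bound p1 C0 C2 HC s0 Hl).
have hsS : has_sup S by split; [exists 1|exists (C `^ p^-1)].
have ltsup s : S s -> s < sup S.
  move=> [s0 Hs]; have [s' ss' Hs'] := reachable_open p1 Hs.
  apply: (lt_le_trans ss'); apply: ub_le_sup; first by case: hsS.
  by split => //; exact: lt_trans ss'.
exists (sup S); split.
  rewrite ltsup//=; apply: (@le_lt_trans _ _ (C `^ p^-1)).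
    by apply: ge_sup => //; exists 1.
  have E2 : (2 `^ p) `^ p^-1 = 2 :> R by rewrite -powRrM mulfV ?gt_eqF// powRr1.
  rewrite -[X in _ < X]E2.
  by apply: gt0_ltr_powR; rewrite ?invr_gt0 ?nnegrE ?powR_ge0.
move=> s s0; split => [Hs|]; first by apply: ltsup; split.
move=> /(sup_gt (ex_intro _ 1 S1))[s' [s'0 [l Hl]] ss'].
by exists l; apply: (lt_le_trans Hl); apply: pairing_mono => //; exact: ltW.
Qed.

End Threshold.

(** * Power sums and optimal approximants *)

Section PowerSum.
Context {R : realType}.
Implicit Types (a b f : nat -> R[i]) (q r : {poly R[i]}).

Definition powsum (p : R) a : \bar R := (\sum_(k <oo) (normc (a k) `^ p)%:E)%E.

Lemma powsum_ge0 p a : (0 <= powsum p a)%E.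
Proof. by apply: nneseries_ge0 => k _ _; rewrite lee_fin powR_ge0. Qed.

Lemma lpA_normE p a : 1 < p -> lpA_norm p a = (powsum p a `^ p^-1)%E.
Proof.
move=> p1; rewrite /lpA_norm Lnorm_counting; last by lra.
congr (_ `^ _)%E; apply: eq_eseriesr => k _ /=.
by rewrite ger0_norm// normc_ge0.
Qed.

(** The p-th root is increasing, so the norm can be minimised through the power sum, which splits
    over the indices. *)
Lemma lpA_norm_le p a b : 1 < p ->
  (lpA_norm p a <= lpA_norm p b)%E = (powsum p a <= powsum p b)%E.
Proof.
move=> p1; have p0 : 0 < p by lra.
rewrite !lpA_normE//; apply/idP/idP => H; last first.
  apply: gt0_ler_poweR => //; rewrite ?invr_ge0 ?(ltW p0)//.
  - by rewrite in_itv/= powsum_ge0 leey.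
  - by rewrite in_itv/= powsum_ge0 leey.
have pow1 (x : \bar R) : (0 <= x)%E -> ((x `^ p^-1) `^ p)%E = x.
  by move=> x0; rewrite -poweRrM mulVf ?gt_eqF// poweRe1.
rewrite -[leLHS]pow1 ?powsum_ge0// -[leRHS]pow1 ?powsum_ge0//.
apply: gt0_ler_poweR => //; rewrite ?(ltW p0)//.
- by rewrite in_itv/= poweR_ge0 leey.
- by rewrite in_itv/= poweR_ge0 leey.
Qed.

Lemma lpAP p a : 1 < p -> lpA p a <-> (powsum p a < +oo)%E.
Proof.
move=> p1; rewrite /lpA /= lpA_normE//; split; last exact: poweR_lty.
by apply: lty_poweRy; rewrite invr_eq0; lra.
Qed.

Lemma powsum_partial p a N : ((\sum_(k < N) normc (a k) `^ p)%:E <= powsum p a)%E.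
Proof.
apply: le_trans (nneseries_lim_ge N _) => [|k _ _]; last by rewrite lee_fin powR_ge0.
by rewrite big_mkord sumEFin.
Qed.

Lemma powsum_split p a N : powsum p a =
  ((\sum_(k < N) normc (a k) `^ p)%:E + \sum_(N <= k <oo) (normc (a k) `^ p)%:E)%E.
Proof.
rewrite /powsum (nneseries_split _ N) => [|k _]; last by rewrite lee_fin powR_ge0.
by rewrite add0n big_mkord sumEFin.
Qed.

Lemma powsum_supp p a N : 1 < p -> (forall k, (N <= k)%N -> a k = 0) ->
  powsum p a = (\sum_(k < N) normc (a k) `^ p)%:E.
Proof.
move=> p1 a0; rewrite (powsum_split p a N) eseries0 ?adde0// => k Nk _.
by rewrite a0// normc0 powR0//; lra.
Qed.

Definition error f q : nat -> R[i] :=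
  fun k => (k == 0%N)%:R - poly_mul_series q f k.

Lemma is_opaP p n f q : 1 < p -> is_opa p n f q <->
  (size q <= n.+1)%N /\ forall r, (size r <= n.+1)%N ->
    (powsum p (error f q) <= powsum p (error f r))%E.
Proof.
move=> p1; split=> -[sq H]; (split; first exact: sq).
  move=> r sr; rewrite -lpA_norm_le// -[leLHS]/(opa_error p f q) H.
  by apply: ereal_inf_lbound; exists r.
apply/le_anti/andP; split; last by apply: ereal_inf_lbound; exists q.
apply: le_ereal_inf_tmp => _ [r sr <-].
by rewrite (lpA_norm_le _ _ p1); exact: (H r sr).
Qed.

Lemma poly_mul_series0 q f : poly_mul_series q f 0 = q`_0 * f 0%N.
Proof. by rewrite /poly_mul_series big_ord_recl big_ord0 addr0. Qed.

Lemma poly_mul_seriesS q f k : (size q <= 2)%N ->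
  poly_mul_series q f k.+1 = q`_0 * f k.+1 + q`_1 * f k.
Proof.
move=> sq; rewrite /poly_mul_series 2!big_ord_recl/= subn0 subSS subn0.
rewrite big1 ?addr0// => i _; rewrite nth_default ?mul0r//.
exact: leq_trans sq _.
Qed.

Lemma powsum_shift p a N : powsum p a =
  ((\sum_(k < N) normc (a k) `^ p)%:E + powsum p (fun k => a (k + N)%N))%E.
Proof.
rewrite (powsum_split p a N) /powsum.
by rewrite -(nneseries_addn _ (f := fun k => (normc (a k) `^ p)%:E))// => k;
  rewrite lee_fin powR_ge0.
Qed.

Lemma powsum_scale p (c : R[i]) a :
  powsum p (fun k => c * a k) = ((normc c `^ p)%:E * powsum p a)%E.
Proof.
rewrite /powsum -nneseriesZl => [|k _]; last by rewrite lee_fin powR_ge0.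
by apply: eq_eseriesr => k _; rewrite normcM powRM ?normc_ge0// EFinM.
Qed.

Lemma powsum_convex p a b (e : R) : 1 < p -> 0 <= e <= 1 ->
  (powsum p (fun k => (a k + e%:C * b k)%R) <=
   (1 - e)%:E * powsum p a + e%:E * powsum p (fun k => (a k + b k)%R))%E.
Proof.
move=> p1 e01; rewrite /powsum -!nneseriesZl; try by move=> k _;
  rewrite lee_fin powR_ge0.
rewrite -nneseriesD; try by move=> k _ _; rewrite lee_fin mulr_ge0 ?powR_ge0//; lra.
apply: lee_nneseries => [k _ _|k _]; first by rewrite lee_fin powR_ge0.
by rewrite -EFinD lee_fin; exact: normc_convex.
Qed.

Lemma powsum_scale_lty p (c : R[i]) a :
  (powsum p a < +oo -> powsum p (fun k => (c * a k)%R) < +oo)%E.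
Proof. by move=> h; rewrite powsum_scale lte_mul_pinfty ?lee_fin ?powR_ge0. Qed.

(* a + b is twice the midpoint of a and b. *)
Lemma powsumD_lty p a b : 1 < p ->
  (powsum p a < +oo -> powsum p b < +oo -> powsum p (fun k => (a k + b k)%R)
    < +oo)%E.
Proof.
move=> p1 fa fb.
have h2 : 2%:C * (2^-1)%:C = 1 :> R[i] by rewrite -rmorphM/= mulfV// rmorph1.
rewrite (_ : (fun k => _) = fun k => 2%:C * (a k + (2^-1)%:C * (b k - a k)));
  last first.
  apply/funext => k; rewrite mulrDr mulrA h2 mul1r.
  by rewrite (_ : 2%:C = 1 + 1 :> R[i]) ?rmorphD ?rmorph1//; ring.
apply: powsum_scale_lty; apply: le_lt_trans (powsum_convex _ _ p1 _) _; first by lra.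
rewrite (_ : (fun k => a k + _) = b); last by apply/funext => k; rewrite addrC subrK.
by apply: lte_add_pinfty; apply: lte_mul_pinfty => //; rewrite lee_fin; lra.
Qed.

(** Coefficients up to N only see a truncation of f, so the algebra of Cauchy products is inherited
    from polynomials. *)
Lemma poly_mul_seriesE q f k N : (k <= N)%N ->
  poly_mul_series q f k = (q * \poly_(i < N.+1) f i)`_k.
Proof.
move=> kN; rewrite coefM; apply: eq_bigr => i _; rewrite coef_poly ifT//.
by rewrite ltnS (leq_trans (leq_subr _ _)).
Qed.

Lemma poly_mul_seriesM q r f k :
  poly_mul_series (q * r) f k = poly_mul_series q (poly_mul_series r f) k.
Proof.
rewrite (poly_mul_seriesE _ _ (leqnn k)) -mulrA coefM; apply: eq_bigr => i _.
by rewrite (poly_mul_seriesE _ _ (leq_subr i k)).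
Qed.

Lemma poly_mul_seriesD q r f k :
  poly_mul_series (q + r) f k = poly_mul_series q f k + poly_mul_series r f k.
Proof. by rewrite !(poly_mul_seriesE _ _ (leqnn k)) mulrDl coefD. Qed.

Lemma poly_mul_seriesC c f k : poly_mul_series c%:P f k = c * f k.
Proof.
by rewrite (poly_mul_seriesE _ _ (leqnn k)) coefCM coef_poly leqnn.
Qed.

Lemma powsum_poly_mul_lty p q f : 1 < p ->
  (powsum p f < +oo -> powsum p (poly_mul_series q f) < +oo)%E.
Proof.
move=> p1; elim/poly_ind: q f => [|q c IH] f fin_f.
  rewrite (@powsum_supp p _ 0) ?big_ord0 ?ltry// => k _.
  by rewrite -[0]/(0%:P) poly_mul_seriesC mul0r.
(* Horner's form q X + c leaves a scalar multiple and a shift, which only prepends a zero. *)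
rewrite (_ : poly_mul_series _ f =
  fun k => poly_mul_series q (poly_mul_series 'X f) k + c * f k); last first.
  by apply/funext => k; rewrite poly_mul_seriesD poly_mul_seriesM poly_mul_seriesC.
apply: (powsumD_lty p1); last exact: powsum_scale_lty.
apply: IH; rewrite (powsum_shift _ _ 1).
rewrite (_ : (fun k => _) = f) ?lte_add_pinfty ?ltry//.
by apply/funext => k; rewrite addn1 poly_mul_seriesS ?size_polyX//
  !coefX/= mul0r add0r mul1r.
Qed.

End PowerSum.

(** * Reachable parameters give zeros *)

Section Construction.
Context {R : realType}.
Implicit Types (f : nat -> R[i]).

(* The sequence h is the error, up to a scalar. Its coefficient h_0 = w0 is free
   and is chosen so as to make h orthogonal to f; the hypothesis is
   the orthogonality of h to the shift of f. *)
Lemma Omega_of_orthogonal (p : R) (z0 : R[i]) f N : 1 < p -> z0 != 0 ->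
  (forall k, (N <= k)%N -> f k = 0) -> f 0%N != 0 ->
  \sum_(k < N) dual p (z0 * f k.+1 - f k) * f k = 0 -> Omega p z0.
Proof.
move=> p1 z00 fN f0 S.
(* w0 solves the orthogonality of h to f for the constant coefficient of h. *)
have [w0 Hw0] := dual_surj
  (- (\sum_(k < N) dual p (z0 * f k.+1 - f k) * f k.+1) / f 0%N) p1.
pose h k := if k is k'.+1 then z0 * f k - f k' else w0.
have S1 : \sum_(k < N.+1) dual p (h k) * f k = 0.
  by rewrite big_ord_recl/= Hw0 divfK// addNr.
pose a := w0 - z0 * f 0%N.
(* If a = 0, then h = z0 f - z f lies in the span of f and z f, hence is orthogonal to itself and
   vanishes, against h_0 = z0 f_0 != 0. *)
have a0 : a != 0.
  apply/eqP => aE; have w0E : w0 = z0 * f 0%N by apply/eqP; rewrite -subr_eq0 -/a aE.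
  have : \sum_(k < N.+1) normc (h k) `^ p = 0.
    apply: complexI; rewrite rmorph_sum/= rmorph0.
    under eq_bigr do rewrite -dual_mul//.
    transitivity (z0 * \sum_(k < N.+1) dual p (h k) * f k
                  - \sum_(k < N) dual p (z0 * f k.+1 - f k) * f k).
      rewrite !big_ord_recl/= mulrDr -addrA w0E; congr (_ + _); first by ring.
      by rewrite mulr_sumr -sumrB; apply: eq_bigr => k _; ring.
    by rewrite S S1 mulr0 subrr.
  move/eqP; rewrite psumr_eq0 => [/allP/(_ ord0 (mem_index_enum _))|k _];
    last exact: powR_ge0.
  rewrite /= powR_eq0 normc_eq0 w0E mulf_eq0 (negbTE z00) (negbTE f0)//.
(* The scaling is dictated by the constant coefficient of the error: 1 + z0 f_0 / a = w0 / a. *)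
pose q := a^-1 *: ('X - z0%:P).
have sq : (size q <= 2)%N.
  by rewrite (leq_trans (size_scale_leq _ _))// size_XsubC.
have q0 : q`_0 = - z0 / a by rewrite coefZ coefB coefX coefC/= sub0r mulrC.
have q1 : q`_1 = a^-1 by rewrite coefZ coefB coefX coefC/= subr0 mulr1.
have hE k : error f q k = h k * a^-1.
  rewrite /error; case: k => [|k].
    rewrite eqxx poly_mul_series0 q0 /=.
    by rewrite -[1%:R](divff a0) /a; field.
  by rewrite /= poly_mul_seriesS// q0 q1; ring.
exists f, 1%N, q; split => //.
- by apply/lpAP => //; rewrite (powsum_supp p1 fN) ltry.
- apply/(is_opaP _ _ _ p1); split; first exact: sq.
  move=> r sr.
  have hN k : (N.+1 <= k)%N -> error f q k = 0.
    case: k => // k Nk; rewrite hE /= (fN k.+1) ?(fN k)//; last exact: leqW.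
    by rewrite mulr0 subr0 mul0r.
  rewrite (powsum_supp p1 hN); apply: le_trans (powsum_partial p _ N.+1).
  rewrite lee_fin.
  (* A competitor changes the error by some v in the span of f and z f. As h is orthogonal to v, the
     tangent inequality rules out any gain. *)
  pose v k := poly_mul_series q f k - poly_mul_series r f k.
  have vE k : error f r k = error f q k + v k by rewrite /error /v; ring.
  have v0 : v 0%N = (q`_0 - r`_0) * f 0%N by rewrite /v !poly_mul_series0; ring.
  have vSk k : v k.+1 = (q`_0 - r`_0) * f k.+1 + (q`_1 - r`_1) * f k.
    by rewrite /v !poly_mul_seriesS//; ring.
  have vS : \sum_(k < N.+1) dual p (h k) * v k = 0.
    transitivity ((q`_0 - r`_0) * (\sum_(k < N.+1) dual p (h k) * f k) +
       (q`_1 - r`_1) * \sum_(k < N) dual p (z0 * f k.+1 - f k) * f k); last first.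
      by rewrite S S1 !mulr0 addr0.
    clearbody v; rewrite !big_ord_recl/= v0 [_ * (_ + \sum_(_ < _) _)]mulrDr -addrA.
    congr (_ + _); first by ring.
    by rewrite !mulr_sumr -big_split/=; apply: eq_bigr => k _; rewrite vSk; ring.
  have : \sum_(k < N.+1) (normc (error f q k) `^ p +
      p * Re (dual p (error f q k) * v k)) <= \sum_(k < N.+1) normc (error f r k) `^ p.
    by apply: ler_sum => k _; rewrite vE; exact: normc_tangent.
  rewrite big_split/= -mulr_sumr -Re_sum.
  under [X in p * Re X]eq_bigr do rewrite hE dualM [dual p (h _) * _]mulrC -mulrA.
  by rewrite -mulr_sumr vS mulr0 mulr0 addr0.
- by rewrite /root /q hornerZ hornerXsubC subrr mulr0.
Qed.

Lemma Omega_of_reachable (p s : R) (z0 : R[i]) : 1 < p -> 0 < s ->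
  reachable p s -> normc z0 = s^-1 -> Omega p z0.
Proof.
move=> p1 s0 [l Hl] nz0; have p0 : 0 < p by lra.
have z00 : z0 != 0 by rewrite -normc_eq0 nz0 invr_eq0 gt_eqF.
(* An entry c followed by 0 contributes -s^(p-1) c^p, so c^p = t offsets twice the real part. Placed
   first, c also makes the constant coefficient nonzero. *)
pose t := 2 * Re (pairing p s l) / s `^ (p - 1).
have t0 : 0 < t by rewrite divr_gt0 ?powR_gt0// mulr_gt0.
pose c := t `^ p^-1.
have c0 : 0 < c by apply: powR_gt0.
have cE : c `^ p = t by rewrite -powRrM mulVf ?gt_eqF// powRr1 ?ltW.
(* The conjugate copy of l cancels the imaginary part of its pairing, and the
   isolated entry c cancels the real part. *)
pose l' := c%:C :: (0 :: (l ++ 0 :: map conjc l)).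
have G0 : pairing p s l' = 0.
  rewrite pairing_cons/= sub0r dualN mulNr.
  rewrite pairing_cons mulr0 add0r pairing_cat0 pairing_conj.
  rewrite dualM -mulrA dual_mul// normc_real gtr0_norm// dual_real// cE.
  rewrite -rmorphM/= /t mulrC divfK ?gt_eqF ?powR_gt0//.
  case: (pairing p s l) => x y; simpc; rewrite mulr_natl mulr2n.
  by rewrite addNr complexr0 rmorph0.
(* u is unimodular with z0 u = 1/s; the twist by u^k carries the orthogonality from 1/s to z0. *)
pose u := (s^-1)%:C / z0.
have zu : z0 * u = (s^-1)%:C by rewrite /u mulrC divfK.
have nu k : normc (u ^+ k) = 1.
  elim: k => [|k IH]; first by rewrite expr0 normc1.
  rewrite exprS normcM IH mulr1 /u normcM normcV nz0 normc_real invrK.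
  by rewrite gtr0_norm ?invr_gt0// mulVf ?gt_eqF.
apply: (@Omega_of_orthogonal _ _ (fun k => u ^+ k * l'`_k) (size l')) => //.
- by move=> k lk; rewrite nth_default ?mulr0.
- by rewrite expr0 mul1r -normc_eq0 normc_real gtr0_norm ?gt_eqF.
have E (k : nat) : z0 * (u ^+ k.+1 * l'`_k.+1) - u ^+ k * l'`_k =
    u ^+ k * ((s^-1)%:C * (l'`_k.+1 - s%:C * l'`_k)).
  have su : (s^-1)%:C * s%:C = 1 :> R[i].
    by rewrite -rmorphM/= mulVf ?gt_eqF// rmorph1.
  by rewrite [(s^-1)%:C * (_ - _)]mulrBr [(s^-1)%:C * (s%:C * _)]mulrA su mul1r
    -zu exprS; ring.
transitivity (dual p (s^-1)%:C * pairing p s l'); last by rewrite G0 mulr0.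
rewrite /pairing mulr_sumr; apply: eq_bigr => k _.
rewrite E !dualM.
have := dual_mul (u ^+ k) p1; rewrite nu powR1 rmorph1 => H.
rewrite -[RHS]mul1r -H; ring.
Qed.

End Construction.

(** * Zeros give reachable parameters *)

Section Necessity.
Context {R : realType}.
Implicit Types (f g : nat -> R[i]) (q r : {poly R[i]}).

Lemma powsum_tail_small p g (e : R) : 0 < e -> (powsum p g < +oo)%E ->
  exists N, (powsum p (fun k => g (k + N)%N) < e%:E)%E.
Proof.
move=> e0 fin_g.
have := nneseries_tail_cvg fin_g (fun k _ => _).
move=> /(_ ltac:(by move=> k; rewrite lee_fin powR_ge0)) cv.
have : \forall N \near \oo, (\sum_(N <= k <oo) (normc (g k) `^ p)%:E < e%:E)%E.
  by apply: (cv [set y | (y < e%:E)%E]); apply: open_ereal_lt'; rewrite lte_fin.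
case=> N _ /(_ N (leqnn N)) /=.
rewrite -(nneseries_addn _ (f := fun k => (normc (g k) `^ p)%:E)) => [|k].
  by exists N.
by rewrite lee_fin powR_ge0.
Qed.

(** With h = (s - s')/s, convexity bounds the tail energy at s' by 1 - h times the one at s plus h
    T. Minimality at s leaves A(s) - A(s') <= h T, and the tangent inequality at s' turns this into
    a bound on the partial pairing. *)
Lemma partial_pairing_lower p s s' g N (T : R) : 1 < p -> 0 < s' -> s' < s ->
  (powsum p (fun k => g k.+1 - s%:C * g k)%R < +oo)%E ->
  (powsum p (fun k => g k.+1 - s%:C * g k)%R <=
   powsum p (fun k => g k.+1 - s'%:C * g k)%R)%E ->
  powsum p (fun k => g (k + N).+1) = T%:E ->
  - (T / (p * s)) <=
    \sum_(k < N) Re (dual p (g k.+1 - s'%:C * g k) * g k).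
Proof.
move=> p1 s'0 s's fin_s H HT.
have s0 : 0 < s by apply: lt_trans s's.
pose A t := \sum_(k < N) normc (g k.+1 - t%:C * g k) `^ p.
pose B t := powsum p (fun k => g (k + N).+1 - t%:C * g (k + N)%N).
have AB t : powsum p (fun k => g k.+1 - t%:C * g k) = ((A t)%:E + B t)%E.
  by rewrite (powsum_shift _ _ N).
pose h := (s - s') / s.
have h0 : 0 < h by rewrite divr_gt0// subr_gt0.
have h1 : h <= 1 by rewrite ler_pdivrMr// mul1r; lra.
have hs : h * s = s - s' by rewrite divfK ?gt_eqF.
have Bs' : (B s' <= (1 - h)%:E * B s + h%:E * T%:E)%E.
  have h01 : 0 <= h <= 1 by rewrite ltW.
  have := powsum_convex (fun k => g (k + N).+1 - s%:C * g (k + N)%N)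
    (fun k => s%:C * g (k + N)%N) p1 h01.
  rewrite (_ : (fun k => _ + h%:C * _) =
      fun k => g (k + N).+1 - s'%:C * g (k + N)%N).
    by under [in X in (_ <= _ + _ * X)%E -> _]eq_fun do rewrite subrK; rewrite HT.
  apply/funext => k; rewrite mulrA -rmorphM/= hs rmorphB/=; ring.
move: H fin_s; rewrite !AB.
have B0 : (0 <= B s)%E by apply: powsum_ge0.
move: Bs' B0; case: (B s) => [b| |] // Bs'; rewrite lee_fin => b0 H _.
have {}H : A s + b <= A s' + ((1 - h) * b + h * T).
  by rewrite -lee_fin !EFinD !EFinM; apply: (le_trans H); rewrite leeD2l.
have : \sum_(k < N) (normc (g k.+1 - s'%:C * g k) `^ p +
    p * Re (dual p (g k.+1 - s'%:C * g k) * (- (s - s')%:C * g k))) <= A s.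
  apply: ler_sum => k _.
  have -> : g k.+1 - s%:C * g k = (g k.+1 - s'%:C * g k) + - (s - s')%:C * g k.
    by rewrite rmorphB/=; ring.
  exact: normc_tangent.
rewrite big_split/= -/(A s').
under eq_bigr do rewrite -rmorphN Re_mulrCA.
rewrite -!mulr_sumr; set P := \sum_(_ < _) _ => HA.
have : (s - s') * (- (T / (p * s))) <= (s - s') * P.
  rewrite -hs; have -> : h * s * - (T / (p * s)) = - (h * T / p).
    by field; rewrite !gt_eqF//; lra.
  rewrite lerNl ler_pdivlMr; last by lra.
  by rewrite -hs in HA; nra.
by rewrite ler_pM2l// subr_gt0.
Qed.

(* Prepending a small multiple of g_0 makes the pairing positive, uniformly in
   s' < s; this is why the threshold itself is not attained. *)
Lemma reachable_of_minimal p s g : 1 < p -> 0 < s ->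
  (powsum p g < +oo)%E -> g 0%N != 0 ->
  (powsum p (fun k => g k.+1 - s%:C * g k)%R < +oo)%E ->
  (forall s', (0 < s' < s)%R ->
    powsum p (fun k => g k.+1 - s%:C * g k)%R <=
    powsum p (fun k => g k.+1 - s'%:C * g k)%R)%E ->
  reachable p s.
Proof.
move=> p1 s0 fin_g g0 fin_s Hmin; have p0 : 0 < p by lra.
(* This x keeps 1 - s' x >= 1/2 for s' < s, so the prepended entry contributes at least c. *)
pose x := (2 * s)^-1; have x0 : 0 < x by rewrite invr_gt0 mulr_gt0.
have xs : x * s = 2^-1 by rewrite /x invfM mulfVK// gt_eqF.
pose c := 2^-1 `^ (p - 1) * (x * normc (g 0%N) `^ p).
have c0 : 0 < c by rewrite !mulr_gt0 ?powR_gt0 ?normc_gt0.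
(* The two losses, from the tail and from cutting off after g_N, become at most c/3 each. *)
pose e := Num.min (p * s * (c / 3)) (c / 3 / s `^ (p - 1)).
have c3 : 0 < c / 3 by rewrite divr_gt0.
have e0 : 0 < e.
  rewrite lt_min; apply/andP; split; last by rewrite (divr_gt0 c3) ?powR_gt0.
  by apply: mulr_gt0 => //; exact: mulr_gt0.
have [N HN] := powsum_tail_small e0 fin_g.
rewrite (powsum_shift _ _ 1) big_ord_recl big_ord0 addr0 add0n in HN.
have T0 := powsum_ge0 p (fun k => g (k + 1 + N)%N).
move: HN T0; case ET : (powsum p (fun k => g (k + 1 + N)%N)) => [T| |] //.
rewrite -EFinD lte_fin lee_fin lt_min => /andP[HN1 HN2] T0.
have HT : powsum p (fun k => g (k + N).+1) = T%:E.
  by rewrite -ET; congr powsum; apply/funext => k; rewrite addn1 addSn.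
have gN0 := powR_ge0 (normc (g N)) p.
exists ((x%:C * g 0%N) :: mkseq g N.+1).
set l := _ :: _.
have H s' : 0 < s' < s -> c / 3 <= Re (pairing p s' l).
  move=> /andP[s'0 s's].
  rewrite pairing_cons ReD pairing_mkseq nth_mkseq//.
  have := partial_pairing_lower p1 s'0 s's fin_s (Hmin s' _) HT.
  rewrite s'0 s's => /(_ isT); set P := \sum_(_ < _) _ => HP.
  have -> : Re (dual p (g 0%N - s'%:C * (x%:C * g 0%N)) * (x%:C * g 0%N)) =
      (1 - s' * x) `^ (p - 1) * (x * normc (g 0%N) `^ p).
    have y0 : 0 < 1 - s' * x by rewrite subr_gt0; nra.
    have -> : g 0%N - s'%:C * (x%:C * g 0%N) = (1 - s' * x)%:C * g 0%N.
      by rewrite rmorphB rmorph1 rmorphM/=; ring.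
    rewrite Re_mulrCA dualM -mulrA dual_mul// dual_real// Re_realM /=; ring.
  have -> : Re (dual p (- (s'%:C * g N)) * g N) =
      - (s' `^ (p - 1) * normc (g N) `^ p).
    by rewrite dualN mulNr ReN dualM -mulrA dual_mul// dual_real// Re_realM.
  have h1 : c <= (1 - s' * x) `^ (p - 1) * (x * normc (g 0%N) `^ p).
    rewrite /c ler_pM2r; last by rewrite mulr_gt0 ?powR_gt0 ?normc_gt0.
    by apply: ge0_ler_powR; rewrite ?nnegrE; nra.
  have h2 : s' `^ (p - 1) * normc (g N) `^ p <= c / 3.
    apply: (@le_trans _ _ (s `^ (p - 1) * normc (g N) `^ p)).
      by rewrite ler_wpM2r//; apply: ge0_ler_powR; rewrite ?nnegrE; lra.
    rewrite mulrC -ler_pdivlMr ?powR_gt0//; lra.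
  have h3 : T / (p * s) <= c / 3.
    rewrite ler_pdivrMr ?mulr_gt0// mulrC; lra.
  lra.
(* By continuity, the uniform bound c/3 for s' < s passes to s. *)
rewrite ltNge; apply/negP => Hs.
have := @pairing_continuous R p l p1 s.
move=> /cvgr_lt /(_ (c / 3)) /(_ ltac:(lra)) [d /= d0 Hd].
pose s' := s - Num.min (d / 2) (s / 2).
have md : 0 < Num.min (d / 2) (s / 2) by rewrite lt_min !divr_gt0.
have md1 : Num.min (d / 2) (s / 2) <= d / 2 by rewrite ge_min lexx.
have md2 : Num.min (d / 2) (s / 2) <= s / 2 by rewrite ge_min lexx orbT.
have : Re (pairing p s' l) < c / 3.
  by apply: Hd; rewrite /= /s' opprB addrCA subrr addr0 gtr0_norm//; lra.
by rewrite ltNge H// /s'; lra.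
Qed.

(** For the constant e / f_0 the error has power sum at most (1 - e) + e^p M. Taking e^(p-1) = 1/(M
    + 1) makes the second term e M/(M + 1) < e. This serves to show that an optimal approximant does
    not vanish at 0. *)
Lemma error_lt1 p f : 1 < p -> (powsum p f < +oo)%E -> f 0%N != 0 ->
  exists c : R[i], (powsum p (error f c%:P) < 1)%E.
Proof.
move=> p1 fin_f f0; have p0 : 0 < p by lra.
have F0 := powsum_ge0 p f.
move: fin_f F0; case EK : (powsum p f) => [K| |] // _; rewrite lee_fin => K0.
pose M := K / normc (f 0%N) `^ p.
have M0 : 0 <= M by rewrite divr_ge0 ?powR_ge0.
pose e := (M + 1)^-1 `^ (p - 1)^-1.
have iM : 0 < (M + 1)^-1 <= 1.
  by rewrite invr_gt0 invf_le1; lra.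
have e0 : 0 < e by rewrite powR_gt0//; case/andP: iM.
have e1 : e <= 1 `^ (p - 1)^-1.
  by case/andP: iM => ? ?; apply: ge0_ler_powR; rewrite ?invr_ge0 ?nnegrE//; lra.
rewrite powR1 in e1.
have eE : e `^ (p - 1) = (M + 1)^-1.
  by rewrite -powRrM mulVf ?powRr1; lra.
exists (e%:C / f 0%N).
rewrite (powsum_shift _ _ 1) big_ord_recl big_ord0 addr0.
have -> : error f (e%:C / f 0%N)%:P 0%N = (1 - e)%:C.
  by rewrite /error poly_mul_seriesC divfK// eqxx rmorphB rmorph1.
rewrite normc_real ger0_norm; last by lra.
rewrite (_ : (fun k => _) = fun k => - (e%:C / f 0%N) * f (k + 1)%N); last first.
  by apply/funext => k; rewrite /error poly_mul_seriesC addn1/= sub0r mulNr.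
rewrite powsum_scale normcN normcM normcV normc_real gtr0_norm//.
have HK : (powsum p (fun k => f (k + 1)%N) <= K%:E)%E.
  by rewrite -EK [leRHS](powsum_shift _ _ 1) leeDr// lee_fin sumr_ge0// => k _;
    exact: powR_ge0.
apply: (@le_lt_trans _ _ ((1 - e)%:E + ((e / normc (f 0%N)) `^ p)%:E * K%:E)%E).
  apply: leeD; last by apply: lee_wpmul2l => //; rewrite lee_fin powR_ge0.
  rewrite lee_fin; have [->|e1'] := eqVneq e 1; first by rewrite subrr powR0//; lra.
  by apply: ge1r_powR; lra.
rewrite -EFinM -EFinD lte_fin.
have -> : (e / normc (f 0%N)) `^ p * K = e * ((M + 1)^-1 * M).
  rewrite powRM ?invr_ge0 ?normc_ge0 ?(ltW e0)// -(mulr_powRB1 (ltW e0) p0) eE.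
  rewrite -[(normc _)^-1]powR_inv1 ?normc_ge0// -powRrM mulN1r powRN /M.
  by rewrite -!mulrA; congr (_ * (_ * _)); rewrite mulrC.
have : (M + 1)^-1 * M < 1 by rewrite mulrC ltr_pdivrMr; lra.
by nra.
Qed.

Lemma reachable_of_Omega p (z0 : R[i]) : 1 < p -> Omega p z0 ->
  z0 != 0 /\ reachable p (normc z0)^-1.
Proof.
move=> p1 [f [n [q [/(lpAP _ p1) fin_f f0 n1 /(is_opaP _ _ _ p1)[sq Hq] rt]]]].
have p0 : 0 < p by lra.
have [c Hc] := error_lt1 p1 fin_f f0.
have sc : (size c%:P <= n.+1)%N by rewrite (leq_trans (size_polyC_leq1 c)).
have err1 : (powsum p (error f q) < 1)%E by apply: le_lt_trans Hc; exact: Hq.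
(* With q(0) = 0 the error would have constant coefficient 1. *)
have q00 : q`_0 != 0.
  apply: contraTneq err1 => q0; rewrite -leNgt.
  apply: le_trans (powsum_partial p _ 1); rewrite big_ord_recl big_ord0 addr0.
  by rewrite /error poly_mul_series0 q0 mul0r subr0 eqxx normc1 powR1.
have z00 : z0 != 0.
  by apply: contraNneq q00 => z0E; rewrite -horner_coef0 -[X in q.[X]]z0E.
split=> //.
have [q1 qE] := factor_theorem _ _ rt.
have q1n0 : q1 != 0 by apply: contraNneq q00 => q10; rewrite qE q10 mul0r coef0.
have sq1 : size q = (size q1).+1 by rewrite qE size_Mmonic ?monicXsubC//
  size_XsubC addn2.
pose g := poly_mul_series q1 f.
have g0 : g 0%N != 0.
  rewrite /g poly_mul_series0 mulf_neq0//.
  apply: contraNneq q00 => q10.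
  by rewrite qE -horner_coef0 hornerM horner_coef0 q10 mul0r.
have fin_g : (powsum p g < +oo)%E by apply: powsum_poly_mul_lty.
(* Only the competitors (t z - z0) q1 are needed; they leave the coefficient of
   index 0 of the error unchanged. *)
pose L (t : R[i]) : {poly R[i]} := t *: 'X - z0%:P.
have sL t : (size (L t) <= 2)%N.
  rewrite (leq_trans (size_polyD _ _))// geq_max size_polyN.
  rewrite (leq_trans (size_scale_leq _ _)) ?size_polyX//=.
  by rewrite (leq_trans (size_polyC_leq1 _)).
have L0 t : (L t)`_0 = - z0 by rewrite coefB coefZ coefX coefC/= mulr0 sub0r.
have L1 t : (L t)`_1 = t by rewrite coefB coefZ coefX coefC/= mulr1 subr0.
have qL : q = L 1 * q1 by rewrite /L scale1r mulrC.
have err0 t : error f (L t * q1) 0%N = error f q 0%N.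
  by rewrite qL /error !poly_mul_seriesM !poly_mul_series0 !L0.
have errS t k : error f (L t * q1) k.+1 = z0 * g k.+1 - t * g k.
  rewrite /error poly_mul_seriesM poly_mul_seriesS// L0 L1 -/g /=; ring.
(* The index 0 contributes the same finite term on both sides and cancels. *)
have Hmin t : (powsum p (fun k => z0 * g k.+1 - 1 * g k)%R <=
               powsum p (fun k => z0 * g k.+1 - t * g k)%R)%E.
  have st : (size (L t * q1)%R <= n.+1)%N.
    rewrite (leq_trans (size_polyMleq _ _))// (leq_trans _ sq)// sq1.
    by rewrite -subn1 leq_subLR add1n -add2n leq_add2r.
  have := Hq _ st; rewrite {1}qL !(powsum_shift p (error f _) 1) !big_ord_recl
    !big_ord0 !addr0.
  rewrite !err0 leeD2lE; last exact: isT.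
  under eq_fun do rewrite addn1 errS.
  by under [in X in (_ <= X)%E -> _]eq_fun do rewrite addn1 errS.
have fin1 : (powsum p (fun k => z0 * g k.+1 - 1 * g k)%R < +oo)%E.
  apply: le_lt_trans (lt_trans err1 (ltry 1)).
  rewrite qL (powsum_shift p (error f _) 1) big_ord_recl big_ord0 addr0.
  under [in X in (_ <= _ + X)%E]eq_fun do rewrite addn1 errS.
  by rewrite leeDr// lee_fin powR_ge0.
pose rho := normc z0; have rho0 : 0 < rho by rewrite normc_gt0.
pose u := rho%:C / z0.
have zu : z0 * u = rho%:C by rewrite /u mulrC divfK.
have nu k : normc (u ^+ k) = 1.
  elim: k => [|k IH]; first by rewrite expr0 normc1.
  rewrite exprS normcM IH mulr1 /u normcM normcV normc_real gtr0_norm//.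
  by rewrite mulfV// gt_eqF.
have u0 : u != 0 by rewrite -normc_eq0 -[u]expr1 nu oner_eq0.
(* The rotation z |-> u z makes z0 real. *)
pose g' k := u ^- k * g k.
have ng' k : normc (g' k) = normc (g k) by rewrite normcM normcV nu invr1 mul1r.
have gg' k : g k = u ^+ k * g' k by rewrite mulrA mulfV ?mul1r// expf_neq0.
(* With t = s' rho, the minimum at t = 1 becomes one at s' = 1/rho. *)
have E (s' : R) : powsum p (fun k => z0 * g k.+1 - (s' * rho)%:C * g k) =
    ((rho `^ p)%:E * powsum p (fun k => (g' k.+1 - s'%:C * g' k)%R))%E.
  rewrite -[rho in RHS](gtr0_norm rho0) -normc_real -powsum_scale.
  apply: eq_eseriesr => k _; congr ((_ `^ _)%:E).
  rewrite !gg' (_ : _ - _ = u ^+ k * (rho%:C * (g' k.+1 - s'%:C * g' k))).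
    by rewrite normcM nu mul1r.
  by rewrite -zu rmorphM/= -zu exprS; ring.
have sr : rho^-1 * rho = 1 by rewrite mulVf// gt_eqF.
have E1 := E rho^-1; rewrite sr rmorph1 in E1.
have pw0 : 0 < rho `^ p by rewrite powR_gt0.
have fin_g' : (powsum p g' < +oo)%E.
  by rewrite /powsum; under eq_eseriesr do rewrite ng'; exact: fin_g.
have g'0 : g' 0%N != 0 by rewrite -normc_eq0 ng' normc_eq0.
have irho0 : 0 < rho^-1 by rewrite invr_gt0.
apply: (reachable_of_minimal p1 irho0 fin_g' g'0).
- move: fin1 (powsum_ge0 p (fun k => g' k.+1 - rho^-1%:C * g' k)); rewrite E1.
  case: (powsum p _) => [r _ _|+ _|//]; first exact: ltry.
  by rewrite gt0_muley ?lte_fin.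
- move=> s' _; have := Hmin (s' * rho)%:C; rewrite E E1.
  by rewrite lee_pmul2l// lte_fin.
Qed.

Lemma closed_unit_discE : closed_unit_disc R = [set z | normc z <= 1].
Proof.
apply/seteqP; split => z /=.
  move=> Hz; rewrite leNgt; apply/negP => z1.
  have e0 : 0 < (normc z - 1)%:C :> R[i] by rewrite ltcR subr_gt0.
  have [y [/= y1]] := Hz _ (nbhsx_ballx (z : R[i]^o) _ e0).
  rewrite -ball_normE /= [`|_|]/((normc (z - y))%:C) ltcR => zy.
  have h : normc z <= normc (z - y) + normc y.
    by rewrite -{1}(subrK y z); exact: le_normcD.
  by move: y1 zy h; rewrite /unit_disc /=; lra.
move=> z1 B /nbhs_ballP[e /= e0 He].
(* Balls have radii in [R[i]]; positivity forces the imaginary part to be 0. *)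
have [d d0 eE] : exists2 d : R, 0 < d & e = d%:C.
  case: e e0 {He} => a b; rewrite ltcE /= => /andP[/eqP-> a0].
  by exists a.
(* Scaling z by 1 - t enters the open disc and moves z by at most d/2. *)
pose t := Num.min (d / 2) 2^-1.
have t0 : 0 < t by rewrite lt_min divr_gt0//= invr_gt0.
have td : t <= d / 2 by rewrite ge_min lexx.
have t2 : t <= 2^-1 by rewrite ge_min lexx orbT.
have nz := normc_ge0 z.
exists ((1 - t)%:C * z); split => /=.
  rewrite /unit_disc /= normcM normc_real gtr0_norm; last by lra.
  by nra.
apply: He; rewrite -ball_normE /= eE [`|_|]/((normc (z - (1 - t)%:C * z))%:C) ltcR.
have -> : z - (1 - t)%:C * z = t%:C * z by rewrite rmorphB rmorph1; ring.
by rewrite normcM normc_real gtr0_norm//; nra.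
Qed.

Lemma Omega_threshold (p : R) : 1 < p -> p != 2 -> exists tau : R,
  1 < tau < 2 /\ Omega p = [set z : R[i] | tau^-1 < normc z].
Proof.
move=> p1 p2; have [tau [/andP[t1 t2] H]] := reachable_threshold p1 p2.
have t0 : 0 < tau by lra.
exists tau; split; first by rewrite t1.
apply/seteqP; split => z /=.
  move=> /(reachable_of_Omega p1)[z0]; rewrite -normc_gt0 in z0.
  by rewrite H ?invr_gt0// -[X in _ < X -> _]invrK ltf_pV2 ?posrE// invr_gt0.
move=> Hz; have nz : 0 < normc z by apply: lt_trans Hz; rewrite invr_gt0.
apply: (@Omega_of_reachable _ p (normc z)^-1) => //; rewrite ?invr_gt0 ?invrK//.
by rewrite H ?invr_gt0// -[tau]invrK ltf_pV2// posrE invr_gt0.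
Qed.

End Necessity.

Theorem theorem1p2 (R : realType) (p : R) (hp1 : 1 < p) (hp2 : p != 2) :
  exists tau : R,
    [/\ 1 < tau < 2,
        Omega p = ~` [set (tau^-1)%:C * w | w in closed_unit_disc R] &
        Omega p = [set z : R[i] | tau^-1 < normc z]].
Proof.
have [tau [t12 H]] := Omega_threshold hp1 hp2.
have t0 : 0 < tau by lra.
have nt : normc (tau^-1)%:C = tau^-1 by rewrite normc_real gtr0_norm ?invr_gt0.
exists tau; split=> //; rewrite H closed_unit_discE.
apply/seteqP; split => z /=.
  move=> Hz [w /= w1 zE]; move: Hz; rewrite -zE normcM nt ltNge.
  by rewrite ger_pMr ?w1// invr_gt0.
move=> Hz; rewrite ltNge; apply/negP => nz; apply: Hz.
exists (tau%:C * z); last by rewrite mulrA -rmorphM/= mulVf ?gt_eqF// rmorph1 mul1r.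
by rewrite /= normcM normc_real gtr0_norm// mulrC -ler_pdivlMr// mul1r.
Qed.
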